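(* Let $R$ be a commutative ring with identity, let $n$ be a positive integer, and let $k$ be a nonnegative integer. Then $$\operatorname{Int}^{(k)}(R[\varepsilon_1,\ldots,\varepsilon_n])=\sum_{i=0}^n(\varepsilon_1,\ldots,\varepsilon_n)^i\,\operatorname{Int}^{(n+k-i)}(R)[\varepsilon_1,\ldots,\varepsilon_n].$$ Equivalently, as $R$-modules, $$\operatorname{Int}^{(k)}(R[\varepsilon_1,\ldots,\varepsilon_n])=\bigoplus_{S\subseteq\{1,2,\ldots,n\}}\operatorname{Int}^{(n+k-|S|)}(R)\,\varepsilon_S.$$
   Context: All rings are commutative with identity. For a ring $A$, $T(A)$ denotes the total quotient ring of $A$, i.e. the localization of $A$ at the multiplicative set of all non-zerodivisors. For a nonnegative integer $m$, $\operatorname{Int}^{(m)}(A)=\{f\in T(A)[X]: f^{(j)}(A)\subseteq A \text{ for all } 0\le j\le m\}$, where $f^{(j)}$ is the $j$-th formal derivative. $R[\varepsilon_1,\ldots,\varepsilon_n]=R[T_1,\ldots,T_n]/(T_1^2,\ldots,T_n^2)$, where $\varepsilon_i$ is the image of $T_i$. For $S\subseteq\{1,\ldots,n\}$, $\varepsilon_S=\prod_{i\in S}\varepsilon_i$; these $2^n$ elements form an $R$-module basis. The total quotient ring of $R[\varepsilon_1,\ldots,\varepsilon_n]$ is identified canonically with $T(R)[\varepsilon_1,\ldots,\varepsilon_n]$, so that $T(R[\varepsilon_1,\ldots,\varepsilon_n])[X]=T(R)[X][\varepsilon_1,\ldots,\varepsilon_n]=\bigoplus_S T(R)[X]\varepsilon_S$,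 and both sides of the equalities are subsets of this ring. For a subring $B\subseteq T(R)[X]$, $B[\varepsilon_1,\ldots,\varepsilon_n]=\bigoplus_S B\varepsilon_S$. $(\varepsilon_1,\ldots,\varepsilon_n)^i$ is the $i$-th power of the ideal of $R[\varepsilon_1,\ldots,\varepsilon_n]$ generated by $\varepsilon_1,\ldots,\varepsilon_n$, and the product of two subsets means the additive subgroup generated by products of their elements. *)

(* Defs.v *)
From HB Require Import structures.
From mathcomp Require Import all_boot all_order all_algebra.
From mathcomp Require Import generic_quotient ring_quotient.
From mathcomp Require Import ring.
From mathcomp Require Import boolp classical_sets.
From mathcomp Require Import mpoly.

Set Implicit Arguments.
Unset Strict Implicit.
Unset Printing Implicit Defensive.

Import GRing.Theory.

Local Open Scope ring_scope.
Local Open Scope quotient_scope.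

Module TotalFrac.
Section TotalFrac.
Variable A : comNzRingType.

(* In a commutative ring, [GRing.lreg s] (injectivity of multiplication by s)
   says that s is a non-zerodivisor. *)
Definition ratio := {x : A * A | `[< GRing.lreg x.2 >]}.

Implicit Types x y z : ratio.

Lemma denP x : GRing.lreg (val x).2.
Proof. exact/asboolP/(valP x). Qed.

Arguments denP : clear implicits.

Definition mk (a s : A) (hs : GRing.lreg s) : ratio :=
  exist (fun x : A * A => `[< GRing.lreg x.2 >]) (a, s) (introT (asboolP _) hs).

Lemma mkE x : mk (val x).1 (denP x) = x.
Proof. by apply: val_inj => /=; rewrite -surjective_pairing. Qed.

(* The defining relation of a localization, [u * (a * t - b * s) = 0] for some
   denominator [u], is the one below because u is a non-zerodivisor. *)
Definition equiv x y := (val x).1 * (val y).2 == (val y).1 * (val x).2.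

Lemma equiv_refl : reflexive equiv.
Proof. by move=> x; rewrite /equiv. Qed.

Lemma equiv_sym : ssrbool.symmetric equiv.
Proof. by move=> x y; rewrite /equiv eq_sym. Qed.

Lemma equiv_trans : transitive equiv.
Proof.
move=> y x z; rewrite /equiv => /eqP xy /eqP yz; apply/eqP.
by apply: (denP y); ring: xy yz.
Qed.

Canonical equiv_equiv := EquivRel equiv equiv_refl equiv_sym equiv_trans.

Definition type := {eq_quot equiv}.

HB.instance Definition _ : EqQuotient _ equiv type := EqQuotient.on type.
HB.instance Definition _ := Choice.on type.

Lemma eq_piE x y :
  (\pi_type x = \pi_type y) <-> (val x).1 * (val y).2 = (val y).1 * (val x).2.
Proof. by split=> [/eqmodP/eqP|/eqP h]; [|apply/eqmodP]. Qed.

Lemma repr_piE x : let r := repr (\pi_type x) in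
  (val r).1 * (val x).2 = (val x).1 * (val r).2.
Proof. by apply/eq_piE; rewrite reprK. Qed.

Definition to_totfrac (a : A) : type := \pi_type (mk a (@GRing.lreg1 A)).

Definition addf x y : ratio :=
  mk ((val x).1 * (val y).2 + (val y).1 * (val x).2)
     (GRing.lregM (denP x) (denP y)).
Definition oppf x : ratio := mk (- (val x).1) (denP x).
Definition mulf x y : ratio :=
  mk ((val x).1 * (val y).1) (GRing.lregM (denP x) (denP y)).

Definition add := lift_op2 type addf.
Definition opp := lift_op1 type oppf.
Definition mul := lift_op2 type mulf.

Lemma add_pi x y : add (\pi_type x) (\pi_type y) = \pi_type (addf x y).
Proof.
unlock add.
apply/eq_piE => /=; have := repr_piE x; have := repr_piE y => /= hy hx.
by ring: hx hy.
Qed.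

Lemma opp_pi x : opp (\pi_type x) = \pi_type (oppf x).
Proof.
unlock opp.
by apply/eq_piE => /=; have := repr_piE x => /= hx; ring: hx.
Qed.

Lemma mul_pi x y : mul (\pi_type x) (\pi_type y) = \pi_type (mulf x y).
Proof.
unlock mul.
apply/eq_piE => /=; have := repr_piE x; have := repr_piE y => /= hy hx.
by ring: hx hy.
Qed.

Lemma addA : associative add.
Proof.
elim/quotW=> x; elim/quotW=> y; elim/quotW=> z.
by rewrite !add_pi; apply/eq_piE => /=; ring.
Qed.

Lemma addC : commutative add.
Proof.
by elim/quotW=> x; elim/quotW=> y; rewrite !add_pi; apply/eq_piE => /=; ring.
Qed.

Lemma add0 : left_id (to_totfrac 0) add.
Proof. by elim/quotW=> x; rewrite add_pi; apply/eq_piE => /=; ring. Qed.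

Lemma addN : left_inverse (to_totfrac 0) opp add.
Proof. by elim/quotW=> x; rewrite opp_pi add_pi; apply/eq_piE => /=; ring. Qed.

HB.instance Definition _ := GRing.isZmodule.Build type addA addC add0 addN.

Lemma mulA : associative mul.
Proof.
elim/quotW=> x; elim/quotW=> y; elim/quotW=> z.
by rewrite !mul_pi; apply/eq_piE => /=; ring.
Qed.

Lemma mulC : commutative mul.
Proof.
by elim/quotW=> x; elim/quotW=> y; rewrite !mul_pi; apply/eq_piE => /=; ring.
Qed.

Lemma mul1 : left_id (to_totfrac 1) mul.
Proof. by elim/quotW=> x; rewrite mul_pi; apply/eq_piE => /=; ring. Qed.

Lemma mul_addl : left_distributive mul add.
Proof.
elim/quotW=> x; elim/quotW=> y; elim/quotW=> z.
by rewrite !(mul_pi, add_pi); apply/eq_piE => /=; ring.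
Qed.

Lemma nonzero1 : to_totfrac 1 != to_totfrac 0.
Proof.
by apply/eqP => /eq_piE /=; rewrite !mulr1 => /eqP; rewrite oner_eq0.
Qed.

HB.instance Definition _ :=
  GRing.Zmodule_isComNzRing.Build type mulA mulC mul1 mul_addl nonzero1.

Lemma pi_addE x y : \pi_type x + \pi_type y = \pi_type (addf x y).
Proof. exact: add_pi. Qed.

Lemma pi_oppE x : - (\pi_type x) = \pi_type (oppf x).
Proof. exact: opp_pi. Qed.

Lemma pi_mulE x y : \pi_type x * \pi_type y = \pi_type (mulf x y).
Proof. exact: mul_pi. Qed.

Lemma to_totfrac_is_zmod_morphism : zmod_morphism to_totfrac.
Proof.
move=> a b; rewrite /to_totfrac pi_oppE pi_addE.
by apply/eq_piE => /=; ring.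
Qed.

Lemma to_totfrac_is_monoid_morphism : monoid_morphism to_totfrac.
Proof.
split=> // a b; rewrite /to_totfrac pi_mulE.
by apply/eq_piE => /=; ring.
Qed.

HB.instance Definition _ :=
  GRing.isZmodMorphism.Build A type to_totfrac to_totfrac_is_zmod_morphism.
HB.instance Definition _ :=
  GRing.isMonoidMorphism.Build A type to_totfrac to_totfrac_is_monoid_morphism.

End TotalFrac.
Arguments denP {A} x.
End TotalFrac.
HB.export TotalFrac.

Notation totfrac := TotalFrac.type.
Notation to_totfrac := (@TotalFrac.to_totfrac _).

Section TotalFracTheory.
Variable A : comNzRingType.

Definition mkfrac (a s : A) (hs : GRing.lreg s) : totfrac A :=
  \pi_(totfrac A) (TotalFrac.mk a hs).

Lemma to_totfrac_inj : injective (@TotalFrac.to_totfrac A).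
Proof. by move=> a b /TotalFrac.eq_piE /=; rewrite !mulr1. Qed.

Lemma mkfracE (a s : A) (hs : GRing.lreg s) :
  mkfrac a hs * to_totfrac s = to_totfrac a.
Proof.
by rewrite /mkfrac /TotalFrac.to_totfrac TotalFrac.pi_mulE;
  apply/TotalFrac.eq_piE => /=; ring.
Qed.

Lemma totfracP (p : totfrac A) :
  exists a s (hs : GRing.lreg s), p = mkfrac a hs.
Proof.
by elim/quotW: p => x; exists (val x).1, (val x).2, (TotalFrac.denP x);
  rewrite /mkfrac TotalFrac.mkE.
Qed.
End TotalFracTheory.

(* The map T(A) -> T(B), a/s |-> f a / f s, induced by a ring morphism which
   sends non-zerodivisors to non-zerodivisors. *)
Section TotalFracMap.
Variables (A B : comNzRingType) (f : {rmorphism A -> B}).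
Hypothesis freg : forall s, GRing.lreg s -> GRing.lreg (f s).

Definition totfrac_map (p : totfrac A) : totfrac B :=
  mkfrac (f (val (repr p)).1) (freg (TotalFrac.denP (repr p))).

Lemma totfrac_mapE (a s : A) (hs : GRing.lreg s) :
  totfrac_map (mkfrac a hs) = mkfrac (f a) (freg hs).
Proof.
apply/TotalFrac.eq_piE; rewrite /= -!rmorphM; congr (f _).
exact: (TotalFrac.repr_piE (TotalFrac.mk a hs)).
Qed.

Lemma totfrac_map_pi (x : TotalFrac.ratio A) :
  totfrac_map (\pi x) = mkfrac (f (val x).1) (freg (TotalFrac.denP x)).
Proof. by rewrite -totfrac_mapE /mkfrac TotalFrac.mkE. Qed.

Lemma totfrac_map_is_zmod_morphism : zmod_morphism totfrac_map.
Proof.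
elim/quotW=> x; elim/quotW=> y.
rewrite TotalFrac.pi_oppE TotalFrac.pi_addE.
rewrite !totfrac_map_pi.
rewrite TotalFrac.pi_oppE TotalFrac.pi_addE; apply/TotalFrac.eq_piE.
by rewrite /= !(rmorphD, rmorphM, rmorphN); ring.
Qed.

Lemma totfrac_map_is_monoid_morphism : monoid_morphism totfrac_map.
Proof.
split.
  rewrite [X in totfrac_map X](_ : _ = mkfrac 1 (@GRing.lreg1 A)) //.
  by rewrite totfrac_mapE; apply/TotalFrac.eq_piE; rewrite /= !rmorph1.
elim/quotW=> x; elim/quotW=> y.
rewrite TotalFrac.pi_mulE.
rewrite !totfrac_map_pi.
rewrite TotalFrac.pi_mulE; apply/TotalFrac.eq_piE.
by rewrite /= !rmorphM; ring.
Qed.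

HB.instance Definition _ := GRing.isZmodMorphism.Build
  (totfrac A) (totfrac B) totfrac_map totfrac_map_is_zmod_morphism.
HB.instance Definition _ := GRing.isMonoidMorphism.Build
  (totfrac A) (totfrac B) totfrac_map totfrac_map_is_monoid_morphism.
End TotalFracMap.

Definition Intder (m : nat) (A : comNzRingType) : set {poly totfrac A} :=
  [set f | forall j, (j <= m)%N ->
     forall a : A, exists b : A, f^`(j).[to_totfrac a] = to_totfrac b].
Arguments Intder m A : clear implicits.

Definition ideal_of (A : comNzRingType) n (g : 'I_n -> A) : set A :=
  [set p | exists q : 'I_n -> A, p = \sum_i q i * g i].

Section SquareZero.
Variables (R : comNzRingType) (n : nat).

Definition sq_ideal : {pred {mpoly R[n]}} :=
  [pred p | `[< ideal_of (fun i : 'I_n => 'X_i ^+ 2) p >]].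

Definition sqfree (m : 'X_{1..n}) := [forall i, m i <= 1]%N.

Lemma sq_idealP p :
  reflect (forall m, sqfree m -> p@_m = 0) (p \in sq_ideal).
Proof.
apply: (iffP (asboolP _)) => [[q ->] m /forallP hm | hp].
  rewrite raddf_sum big1 //= => i _.
  rewrite mpolyXn [q i]mpolyE mulr_suml raddf_sum big1 //= => k _.
  rewrite -scalerAl mcoeffZ -mpolyXD mcoeffX.
  case: eqP => [e|]; last by rewrite mulr0.
  by have := hm i; rewrite -e mnmDE mulmnE mnm1E eqxx mul1n addn2.
rewrite [p]mpolyE; elim/big_ind: _.
- by exists (fun=> 0); rewrite big1 // => i _; rewrite mul0r.
- move=> _ _ [q1 ->] [q2 ->]; exists (fun i => q1 i + q2 i).
  by rewrite -big_split; apply: eq_bigr => i _; rewrite mulrDl.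
move=> m _; case: (boolP (sqfree m)) => [/hp ->|].
  by exists (fun=> 0); rewrite scale0r big1 // => i _; rewrite mul0r.
rewrite negb_forall => /existsP[i]; rewrite -ltnNge => hi.
exists (fun j => if j == i then p@_m *: 'X_[m - U_(i) *+ 2] else 0).
rewrite (bigD1 i) //= eqxx big1 ?addr0 => [|j /negPf ->]; last by rewrite mul0r.
rewrite mpolyXn -scalerAl -mpolyXD submK //.
apply/mnm_lepP => j; rewrite mulmnE mnm1E.
by case: eqP => [<-|]; rewrite ?mul1n ?mul0n.
Qed.

Lemma sq_ideal_closed : idealr_closed sq_ideal.
Proof.
split.
- by apply/sq_idealP => m _; rewrite mcoeff0.
- apply/sq_idealP => /(_ 0%MM); rewrite mcoeff1 eqxx => h.
  have : sqfree 0%MM by apply/forallP => i; rewrite mnm0E.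
  by move/h/eqP; rewrite oner_eq0.
move=> a p q /asboolP[c ->] /asboolP[d ->]; apply/asboolP.
exists (fun i => a * c i + d i); rewrite mulr_sumr -big_split.
by apply: eq_bigr => i _; rewrite mulrDl mulrA.
Qed.

HB.instance Definition _ := isIdealr.Build _ sq_ideal sq_ideal_closed.

Definition eps_ring := {ideal_quot sq_ideal}.
HB.instance Definition _ := GRing.ComNzRing.on eps_ring.

Definition eps (i : 'I_n) : eps_ring := \pi 'X_i.
Definition epsS (S : {set 'I_n}) : eps_ring := \prod_(i in S) eps i.

Definition eps_scalar (r : R) : eps_ring := \pi r%:MP.

Lemma eps_scalar_is_zmod_morphism : zmod_morphism eps_scalar.
Proof. by move=> a b; rewrite /eps_scalar mpolyCB !piE. Qed.

Lemma eps_scalar_is_monoid_morphism : monoid_morphism eps_scalar.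
Proof. by split=> [|a b]; rewrite /eps_scalar ?mpolyC1 ?mpolyCM !piE. Qed.

HB.instance Definition _ := GRing.isZmodMorphism.Build
  R eps_ring eps_scalar eps_scalar_is_zmod_morphism.
HB.instance Definition _ := GRing.isMonoidMorphism.Build
  R eps_ring eps_scalar eps_scalar_is_monoid_morphism.

Lemma eps_scalar_lreg s : GRing.lreg s -> GRing.lreg (eps_scalar s).
Proof.
move=> hs x y; rewrite -[x]reprK -[y]reprK /eps_scalar.
move: (repr x) (repr y) => p q.
rewrite -!rmorphM => /eqP; rewrite -Quotient.idealrBE -mulrBr => /sq_idealP h.
apply/eqP; rewrite -Quotient.idealrBE; apply/sq_idealP => m /h.
by rewrite mul_mpolyC mcoeffZ -[RHS](mulr0 s) => /hs.
Qed.

Definition totfrac_eps : {rmorphism totfrac R -> totfrac eps_ring} :=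
  totfrac_map eps_scalar_lreg.

(* The element \sum_S g_S eps_S of T(R[eps])[X], the polynomials g_S in T(R)[X]
   being mapped to T(R[eps])[X] by the canonical map T(R) -> T(R[eps]).  That
   the sum of the T(R)[X] eps_S is direct is the injectivity of [eps_comb]. *)
Definition eps_comb (g : {ffun {set 'I_n} -> {poly totfrac R}}) :
    {poly totfrac eps_ring} :=
  \sum_S map_poly totfrac_eps (g S) * (to_totfrac (epsS S))%:P.

(* B[eps_1, ..., eps_n] as a subset of T(R[eps])[X] *)
Definition eps_ext (B : set {poly totfrac R}) : set {poly totfrac eps_ring} :=
  eps_comb @` [set g : {ffun {set 'I_n} -> {poly totfrac R}} |
                 forall S, B (g S)].

End SquareZero.

(* The product of two subsets is the additive subgroup that the products of
   their elements generate. *)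
Definition mulset (V : comNzRingType) (A B : set V) : set V :=
  smallest (fun H : set V => GRing.zmod_closed (mem H))
    [set a * b | a in A & b in B].

Definition ideal_pow (A : comNzRingType) (I : set A) (i : nat) : set A :=
  iter i (mulset I) setT.

Definition sumset (V : zmodType) m (F : 'I_m -> set V) : set V :=
  [set \sum_i h i | h in [set h : 'I_m -> V | forall i, F i (h i)]].

(* Main.v *)
Require Import Defs.
From HB Require Import structures.
From mathcomp Require Import all_boot all_order all_algebra.
From mathcomp Require Import generic_quotient ring_quotient ring zify mpoly.
From mathcomp Require Import boolp classical_sets.

Set Implicit Arguments.
Unset Strict Implicit.
Unset Printing Implicit Defensive.

Import GRing.Theory.

Local Open Scope ring_scope.
Local Open Scope quotient_scope.

(** Write A = R[eps_1, ..., eps_n].  Everything rests on the first-order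
    Taylor formula f(x + e) = f(x) + f'(x) e for e^2 = 0, which holds without
    dividing by factorials and is used one square-zero summand at a time.

    The eps_S form an R-basis of A ([eps_expand], [eps_sum_eq0]).  Every
    non-zerodivisor of A has a multiple that is a non-zerodivisor of R
    ([eps_lreg_scalar]), so they are also a T(R)-basis of T(A)
    ([totfrac_eps_expand], [totfrac_eps_sum_eq0]).  Hence each f in T(A)[X] is
    uniquely \sum_S g_S eps_S with g_S in T(R)[X].

    If f lies in Int^(k)(A) and e^2 = 0, then e f lies in Int^(k+1)(A), since
    f^(j+1)(x) e = f^(j)(x + e) - f^(j)(x) ([Intder_mul_sq0]); so eps_U f lies
    in Int^(k+|U|)(A).  Take for U the complement of S, and evaluate at a in R:
    the terms that survive in \sum_T g_T^(j)(a) eps_T eps_U are those with T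
    included in S.  Those with T strictly smaller are removed by induction on
    |S|, and what remains says that g_S^(j)(a) is in R for all j <= k + n - |S|
    ([ring_image_coord], [Intder_coord]).

    Conversely, let h be in Int^(n-|S|)(R), and x in A.  Add the terms of x to
    its constant term one after the other: a new term c eps_T changes
    h(x) eps_S by h'(x) c eps_T eps_S, which is zero or a multiple of
    h'(x) eps_(S u T), where h' has lost one derivative while S has gained at
    least one index.  So h(x) eps_S stays in A ([ring_image_map_horner_epsS]),
    and applying this to the derivatives of h gives the direct sum description
    ([Intder_eps_combP]).

    For the description by powers of the ideal I = (eps_1, ..., eps_n), one
    inclusion holds because eps_S is in I^|S|.  For the other, multiplying
    eps_S by a generator eps_i of I gives zero or enlarges S by one element,
    so an element of I^i compensates for the loss of i derivatives
    ([Intder_ideal_pow]). *)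

(** * The basis of squarefree monomials *)

Lemma ideal_of_gen (B : comNzRingType) n (g : 'I_n -> B) i : ideal_of g (g i).
Proof.
exists (fun j => (j == i)%:R); rewrite (bigD1 i) //= eqxx mul1r.
by rewrite big1 ?addr0 // => j /negPf ->; rewrite mul0r.
Qed.

Section EpsBasis.
Variables (R : comNzRingType) (n : nat).
Implicit Types (S T : {set 'I_n}) (i : 'I_n).
Local Notation A := (eps_ring R n).
Local Notation epsS := (@epsS R n).
Local Notation eps := (@eps R n).
Local Notation "c %:E" := (@eps_scalar R n c) (at level 2).

Lemma eps_sq i : eps i * eps i = 0.
Proof.
rewrite /Defs.eps -rmorphM -[RHS](rmorph0 \pi_A).
apply/eqP; rewrite -Quotient.idealrBE subr0.
exact/asboolP/(ideal_of_gen (fun j => 'X_j ^+ 2)).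
Qed.

Lemma epsS0 : epsS finset.set0 = 1.
Proof. by rewrite /Defs.epsS big_set0. Qed.

Lemma epsS1 i : epsS [set i]%SET = eps i.
Proof. by rewrite /Defs.epsS big_set1. Qed.

Lemma epsSU S T : [disjoint S & T] -> epsS S * epsS T = epsS (S :|: T).
Proof.
move=> dST; rewrite /Defs.epsS -bigU //=.
by apply: eq_bigl => i; rewrite !inE.
Qed.

Lemma epsSM0 S T : ~~ [disjoint S & T] -> epsS S * epsS T = 0.
Proof.
case/pred0Pn => i /= /andP[iS iT].
rewrite /Defs.epsS (big_setD1 i iS) (big_setD1 i iT) /=.
by rewrite mulrACA eps_sq mul0r.
Qed.

Lemma epsS_sq S : S != finset.set0 -> epsS S * epsS S = 0.
Proof. by move=> S0; apply: epsSM0; rewrite -setI_eq0 finset.setIid. Qed.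

Lemma epsSE S : epsS S = \pi_A 'X_[mesym1 S].
Proof.
rewrite /Defs.epsS /Defs.eps -rmorph_prod /= mprodXE; congr (\pi 'X_[_]).
apply/mnmP => i; rewrite mnmE mnm_sumE.
under eq_bigr do rewrite mnm1E.
case: (boolP (i \in S)) => iS.
  rewrite (big_setD1 i iS) /= eqxx big1 // => j.
  by rewrite !inE => /andP[/negPf ->].
by rewrite big1 // => j jS; case: eqP iS => // <-; rewrite jS.
Qed.

Lemma sqfree_mesym1 S : sqfree (mesym1 S).
Proof. by apply/forallP => i; rewrite mnmE; case: (i \in S). Qed.

Lemma eps_expand (x : A) :
  exists c : {set 'I_n} -> R, x = \sum_S (c S)%:E * epsS S.
Proof.
exists (fun S => (repr x)@_(mesym1 S)); rewrite -{1}[x]reprK.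
rewrite /eps_scalar; under eq_bigr do rewrite epsSE -rmorphM mul_mpolyC.
rewrite -rmorph_sum /=; apply/eqP; rewrite -Quotient.idealrBE.
apply/sq_idealP => m sm; rewrite mcoeffB raddf_sum /=.
have -> : m = mesym1 [set i | m i != 0]%SET.
  apply/mnmP => i; rewrite mnmE inE; move/forallP: sm => /(_ i).
  by case: (m i) => [|[|]].
rewrite (bigD1 [set i | m i != 0]%SET) //= mcoeffZ mcoeffX eqxx mulr1.
rewrite big1 ?addr0 ?subrr // => T nT; rewrite mcoeffZ mcoeffX.
by rewrite (inj_eq (@inj_mesym1 n)) (negPf nT) mulr0.
Qed.

Lemma eps_sum_eq0 (c : {set 'I_n} -> R) :
  \sum_S (c S)%:E * epsS S = 0 -> forall S, c S = 0.
Proof.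
rewrite /eps_scalar; under eq_bigr do rewrite epsSE -rmorphM mul_mpolyC.
rewrite -rmorph_sum -[RHS](rmorph0 \pi_A) => /eqP.
rewrite -Quotient.idealrBE subr0 => /sq_idealP h S.
have := h _ (sqfree_mesym1 S); rewrite raddf_sum /= (bigD1 S) //=.
rewrite mcoeffZ mcoeffX eqxx mulr1 big1 ?addr0 // => T nT.
by rewrite mcoeffZ mcoeffX (inj_eq (@inj_mesym1 n)) (negPf nT) mulr0.
Qed.

Lemma eps_sum_inj (b c : {set 'I_n} -> R) :
  \sum_S (b S)%:E * epsS S = \sum_S (c S)%:E * epsS S -> b =1 c.
Proof.
move=> e S; apply/eqP; rewrite -subr_eq0; apply/eqP.
apply: (eps_sum_eq0 (c := fun S => b S - c S)).
under eq_bigr do rewrite rmorphB mulrBl.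
by rewrite sumrB e subrr.
Qed.

(** Non-constant terms c eps_S of s are removed one at a time: the product
    (z + c eps_S) (z - c eps_S) is z^2, because eps_S squares to zero.  The
    constant term that remains is a non-zerodivisor since s acts on the
    multiples of eps_{1,...,n} through it. *)
Lemma eps_lreg_scalar (s : A) : GRing.lreg s ->
  exists u r, GRing.lreg r /\ s * u = r%:E.
Proof.
have [c ->] := eps_expand s; rewrite (bigD1 finset.set0) //= epsS0 mulr1 => hs.
have hc : GRing.lreg (c finset.set0).
  move=> a b hab; apply/eqP; rewrite -subr_eq0; apply/eqP.
  (* s annihilates (a - b) eps_{1,...,n} as soon as its constant term
     annihilates a - b. *)
  pose top a : {set 'I_n} -> R := fun S => if S == finset.setT then a else 0.
  suff: top (a - b) finset.setT = 0 by rewrite /top eqxx.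
  apply: eps_sum_eq0; rewrite (bigD1 finset.setT) //=.
  rewrite big1 ?addr0 => [|S nS]; last first.
    by rewrite /top (negPf nS) rmorph0 mul0r.
  rewrite /top eqxx; apply: hs; rewrite mulr0 mulrDl [X in _ + X]mulr_suml.
  rewrite big1 ?addr0 => [|S S0]; last first.
    rewrite mulrACA epsSM0 ?mulr0 //.
    by rewrite -setI_eq0 finset.setIT.
  by rewrite mulrA -rmorphM mulrBr hab subrr rmorph0 mul0r.
have : exists u r, GRing.lreg r /\ (c finset.set0)%:E * u = r%:E.
  by exists 1, (c finset.set0); rewrite mulr1.
move: {hs hc} (c finset.set0)%:E => z hz.
move: z hz; elim/big_rec : _ => [z|]; first by rewrite addr0.
move=> S y S0 IH z [u [r [hr e]]]; rewrite addrA; apply: IH.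
exists ((z - (c S)%:E * epsS S) * (u * u)), (r * r); split; first exact: lregM.
rewrite rmorphM /= -e.
have /= := epsS_sq S0; move: (epsS S) (c S)%:E => g d q.
by ring: q.
Qed.

End EpsBasis.

(** * The copy of a ring in its total quotient ring *)

Definition ring_image (A : comNzRingType) : {pred totfrac A} :=
  [pred x | `[< exists a : A, x = to_totfrac a >]].

Arguments ring_image A : clear implicits.

Section RingImage.
Variable A : comNzRingType.

Lemma ring_imageP (x : totfrac A) :
  reflect (exists a, x = to_totfrac a) (x \in ring_image A).
Proof. exact: asboolP. Qed.

Lemma ring_image_to_totfrac (a : A) : to_totfrac a \in ring_image A.
Proof. by apply/ring_imageP; exists a. Qed.

Lemma ring_image_subring_closed : subring_closed (ring_image A).
Proof.
split; first by apply/ring_imageP; exists 1; rewrite rmorph1.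
- move=> _ _ /ring_imageP[a ->] /ring_imageP[b ->].
  by apply/ring_imageP; exists (a - b); rewrite rmorphB.
- move=> _ _ /ring_imageP[a ->] /ring_imageP[b ->].
  by apply/ring_imageP; exists (a * b); rewrite rmorphM.
Qed.

HB.instance Definition _ :=
  GRing.isSubringClosed.Build _ (ring_image A) ring_image_subring_closed.

End RingImage.

(** * Polynomials integer-valued with their derivatives *)

Section IntderTheory.
Variable A : comNzRingType.
Implicit Types (f g : {poly totfrac A}) (m j : nat) (a e : A).

Lemma IntderP m f : Intder m A f <->
  forall j a, (j <= m)%N -> f^`(j).[to_totfrac a] \in ring_image A.
Proof.
split=> h j; first by move=> a jm; apply/ring_imageP; exact: h.
by move=> jm a; apply/ring_imageP; exact: h.
Qed.

Lemma Intder0 m : Intder m A 0.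
Proof. by apply/IntderP => j a _; rewrite raddf0 horner0 rpred0. Qed.

Lemma IntderB m f g : Intder m A f -> Intder m A g -> Intder m A (f - g).
Proof.
move=> /IntderP hf /IntderP hg; apply/IntderP => j a jm.
by rewrite derivnB hornerD hornerN rpredB ?hf ?hg.
Qed.

Lemma IntderD m f g : Intder m A f -> Intder m A g -> Intder m A (f + g).
Proof.
move=> hf hg; rewrite -[g]opprK; apply: IntderB hf _.
by rewrite -sub0r; apply: IntderB hg; apply: Intder0.
Qed.

Lemma Intder_sum m (I : Type) (r : seq I) (P : pred I)
    (F : I -> {poly totfrac A}) :
  (forall i, P i -> Intder m A (F i)) -> Intder m A (\sum_(i <- r | P i) F i).
Proof.
by move=> h; elim/big_ind: _ => //; [exact: Intder0 | exact: IntderD].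
Qed.

Lemma Intder_scale m a f : Intder m A f -> Intder m A (to_totfrac a *: f).
Proof.
move=> /IntderP hf; apply/IntderP => j b jm.
by rewrite derivnZ hornerZ rpredM ?ring_image_to_totfrac ?hf.
Qed.

Lemma Intder_le m m' f : (m <= m')%N -> Intder m' A f -> Intder m A f.
Proof.
by move=> le /IntderP hf; apply/IntderP => j a jm; apply/hf/(leq_trans jm).
Qed.

Lemma Intder_derivn m j f : Intder (m + j) A f -> Intder m A f^`(j).
Proof.
move=> /IntderP hf; apply/IntderP => i a im.
by rewrite /derivn -iterD -/(derivn _ _) hf // leq_add2r.
Qed.

Lemma horner_sq0 (B : comNzRingType) (p : {poly B}) (x y : B) :
  y * y = 0 -> p.[x + y] = p.[x] + p^`().[x] * y.
Proof.
move=> y0; elim/poly_ind: p => [|p c IH].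
  by rewrite deriv0 !horner0 mul0r addr0.
by rewrite derivMXaddC !hornerE IH; ring: y0.
Qed.

(** The derivative of order m + 1 at a, multiplied by e, is the difference
    of the values of the derivative of order m at a + e and at a. *)
Lemma Intder_mul_sq0 m e f : e * e = 0 ->
  Intder m A f -> Intder m.+1 A (to_totfrac e *: f).
Proof.
move=> e0 /IntderP hf; apply/IntderP => -[|j] a jm; rewrite derivnZ hornerZ.
  by rewrite rpredM ?ring_image_to_totfrac ?hf.
have := @horner_sq0 _ f^`(j) (to_totfrac a) (to_totfrac e).
rewrite -rmorphM e0 rmorph0 -derivnS -rmorphD => /(_ erefl) /(canLR (addKr _)).
rewrite mulrC => <-.
by rewrite addrC rpredB ?hf.
Qed.

Lemma Intder_zmod_closed m : GRing.zmod_closed (mem (Intder m A)).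
Proof.
split=> [|f g]; rewrite !inE; first exact: Intder0.
exact: IntderB.
Qed.

End IntderTheory.

(** * The total quotient ring of the square-zero extension *)

Section TotalQuotient.
Variable A : comNzRingType.

Lemma totfrac_den (x : totfrac A) :
  exists a s, GRing.lreg s /\ x * to_totfrac s = to_totfrac a.
Proof.
by have [a [s [hs ->]]] := totfracP x; exists a, s; rewrite mkfracE.
Qed.

Lemma totfrac_inv (s : A) : GRing.lreg s -> exists y, to_totfrac s * y = 1.
Proof. by move=> hs; exists (mkfrac 1 hs); rewrite mulrC mkfracE rmorph1. Qed.

End TotalQuotient.

Section EpsTotal.
Variables (R : comNzRingType) (n : nat).
Implicit Types (S T : {set 'I_n}) (i : 'I_n).
Local Notation A := (eps_ring R n).
Local Notation E S := (to_totfrac (@epsS R n S)).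
Local Notation iota := (totfrac_eps R n).

Lemma totfrac_eps_scalar (a : R) :
  iota (to_totfrac a) = to_totfrac (@eps_scalar R n a).
Proof.
apply: etrans (totfrac_mapE (@eps_scalar_lreg R n) a (@GRing.lreg1 R)) _.
by apply/TotalFrac.eq_piE; rewrite /= rmorph1.
Qed.

(** A fraction p / s is rewritten as p u / r, where r = s u is a scalar, and
    then p u is expanded on the basis of the ring of numerators. *)
Lemma totfrac_eps_expand (x : totfrac A) :
  exists t : {set 'I_n} -> totfrac R, x = \sum_S iota (t S) * E S.
Proof.
have [p [s [hs xs]]] := totfrac_den x.
have [u [r [hr su]]] := eps_lreg_scalar hs.
have [y ry] := totfrac_inv hr.
have [c pu] := eps_expand (p * u).
exists (fun S => to_totfrac (c S) * y).
have /(congr1 iota) := ry.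
rewrite rmorphM rmorph1 totfrac_eps_scalar -su => ry'.
rewrite -[x]mulr1 -ry' !rmorphM !mulrA xs -rmorphM pu rmorph_sum mulr_suml.
apply: eq_bigr => S _.
by rewrite !rmorphM totfrac_eps_scalar /= mulrAC.
Qed.

(** Only the top monomial is needed: the other coordinates are reached by
    multiplying with the complementary monomial. *)
Lemma ring_image_top (t : totfrac R) :
  iota t * E finset.setT \in ring_image A -> t \in ring_image R.
Proof.
case/ring_imageP => b; have [c ->] := eps_expand b.
have [a [s [hs ts]]] := totfrac_den t => e.
pose top S := if S == finset.setT then a else 0.
have : top =1 fun S => s * c S.
  apply: (@eps_sum_inj R n); apply: to_totfrac_inj.
  rewrite (bigD1 finset.setT) //= big1 ?addr0 => [|S nS]; last first.
    by rewrite /top (negPf nS) rmorph0 mul0r.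
  under eq_bigr do rewrite rmorphM -mulrA.
  rewrite -mulr_sumr !rmorphM /= -e mulrA; congr (_ * _).
  by rewrite -!totfrac_eps_scalar -rmorphM mulrC ts /top eqxx.
move/(_ finset.setT); rewrite /top eqxx => ea.
apply/ring_imageP; exists (c finset.setT).
have [y sy] := totfrac_inv hs.
by rewrite -[t]mulr1 -sy mulrA ts ea rmorphM mulrAC sy mul1r.
Qed.

(** Multiplication by the monomial of the complement of S kills the terms
    with T not included in S and moves the term of S to the top monomial.  The
    hypothesis passes from S to its subsets, whose complements are larger, so
    by induction the coordinates of the proper subsets of S are already in R,
    and their terms can be subtracted. *)
Lemma ring_image_coord (t : {set 'I_n} -> totfrac R) S :
  (\sum_T iota (t T) * E T) * E (~: S) \in ring_image A -> t S \in ring_image R.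
Proof.
have [m] := ubnP #|S|; elim: m S => // m IH S; rewrite ltnS => Sm h.
apply: ring_image_top; move: (h).
rewrite mulr_suml (bigD1 S) //= -mulrA -rmorphM.
have -> : epsS R S * epsS R (~: S) = epsS R [set: 'I_n]%SET.
  by rewrite epsSU ?finset.setUCr // -setI_eq0 finset.setICr.
rewrite rpredDr //; apply: rpred_sum => T nTS; rewrite -mulrA -rmorphM.
have [dTS|/epsSM0 ->] := boolP [disjoint T & ~: S]; last first.
  by rewrite rmorph0 mulr0 rpred0.
have sTS : T \subset S by rewrite finset.disjoints_subset finset.setCK in dTS.
rewrite rpredM ?ring_image_to_totfrac //.
have pTS : T \proper S by rewrite finset.properEneq nTS.
have /ring_imageP[b ->] : t T \in ring_image R.
  apply: IH; first exact: leq_trans (proper_card pTS) Sm.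
  have -> : epsS R (~: T) = epsS R (~: S) * epsS R (S :\: T).
    rewrite epsSU; last first.
      rewrite disjoint_sym finset.disjoints_subset finset.setDE finset.setCK.
      exact: finset.subsetIl.
    congr epsS; apply/setP => i; rewrite !inE; have := fintype.subsetP sTS i.
    by case: (i \in T) => [->|] //=; case: (i \in S).
  by rewrite rmorphM mulrA rpredM ?ring_image_to_totfrac.
by rewrite totfrac_eps_scalar ring_image_to_totfrac.
Qed.

(** Zero is integral, so all the coordinates are in R, where the monomials
    are known to be independent. *)
Lemma totfrac_eps_sum_eq0 (t : {set 'I_n} -> totfrac R) :
  \sum_S iota (t S) * E S = 0 -> forall S, t S = 0.
Proof.
move=> t0; have ht S : exists b, t S == to_totfrac b.
  have /ring_imageP[b ->] : t S \in ring_image R.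
    by apply: ring_image_coord; rewrite t0 mul0r rpred0.
  by exists b.
pose c S := xchoose (ht S).
have tc S : t S = to_totfrac (c S) by apply/eqP/(xchooseP (ht S)).
move=> S; rewrite tc (eps_sum_eq0 (c := c)) ?rmorph0 //.
apply: to_totfrac_inj; rewrite rmorph0 -t0 rmorph_sum.
by apply: eq_bigr => T _; rewrite rmorphM /= -totfrac_eps_scalar tc.
Qed.

End EpsTotal.

(** * Coordinates of integer-valued polynomials *)

Section EpsPoly.
Variables (R : comNzRingType) (n : nat).
Implicit Types (S T U : {set 'I_n}) (i : 'I_n).
Implicit Types (g : {ffun {set 'I_n} -> {poly totfrac R}}).
Implicit Types (h : {poly totfrac R}).
Local Notation A := (eps_ring R n).
Local Notation E S := (to_totfrac (@epsS R n S)).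
Local Notation iota := (totfrac_eps R n).

Lemma eps_combE g : eps_comb g = \sum_S E S *: map_poly iota (g S).
Proof. by apply: eq_bigr => S _; rewrite mulrC mul_polyC. Qed.

Lemma coef_eps_comb g j : (eps_comb g)`_j = \sum_S iota (g S)`_j * E S.
Proof.
rewrite /eps_comb coef_sum; apply: eq_bigr => S _.
by rewrite coefMC coef_map.
Qed.

Lemma eps_comb_inj : injective (@eps_comb R n).
Proof.
move=> g1 g2 e; apply/ffunP => S; apply/polyP => j; apply/eqP.
rewrite -subr_eq0; apply/eqP.
apply: (totfrac_eps_sum_eq0 (t := fun S => (g1 S)`_j - (g2 S)`_j)).
under eq_bigr do rewrite rmorphB mulrBl.
by rewrite sumrB -!coef_eps_comb e subrr.
Qed.

Lemma eps_comb_surj (f : {poly totfrac A}) : exists g, f = eps_comb g.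
Proof.
have /choice[t ht] j := totfrac_eps_expand f`_j.
exists [ffun S => \poly_(j < size f) t j S]; apply/polyP => j.
rewrite coef_eps_comb; under eq_bigr do rewrite ffunE coef_poly.
case: ltnP => [_|/(nth_default 0) ->]; first exact: ht.
by rewrite big1 // => S _; rewrite rmorph0 mul0r.
Qed.

Lemma derivn_eps_comb_scalar g j (a : R) :
  (eps_comb g)^`(j).[to_totfrac (@eps_scalar R n a)] =
  \sum_S iota (g S)^`(j).[to_totfrac a] * E S.
Proof.
rewrite eps_combE (raddf_sum (derivn j)) horner_sum; apply: eq_bigr => S _ /=.
by rewrite derivnZ derivn_map hornerZ -totfrac_eps_scalar horner_map mulrC.
Qed.

Lemma eps_comb_const h :
  eps_comb [ffun T : {set 'I_n} => if T == finset.set0 then h else 0] =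
  map_poly iota h.
Proof.
rewrite eps_combE (bigD1 finset.set0) //= big1 => [|T /negPf T0].
  by rewrite ffunE eqxx epsS0 rmorph1 scale1r addr0.
by rewrite ffunE T0 rmorph0 scaler0.
Qed.

Lemma epsS_ind (P : nat -> A -> Prop) : P 0%N 1 ->
  (forall m i S, P m (epsS R S) -> P m.+1 (eps R i * epsS R S)) ->
  forall S, P #|S| (epsS R S).
Proof.
move=> P0 PS S; move em: #|S| => m; elim: m S em => [|m IH] S em.
  by rewrite (cards0_eq em) epsS0.
have /card_gt0P[i iS] : (0 < #|S|)%N by rewrite em.
rewrite /epsS (big_setD1 i iS); apply/PS/IH.
by move: em; rewrite (cardsD1 i) iS => -[].
Qed.

(** Each factor eps_i squares to zero, and so buys one more derivative. *)
Lemma Intder_epsS k f U : Intder k A f -> Intder (k + #|U|) A (E U *: f).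
Proof.
move=> hf; apply: (@epsS_ind (fun m x => Intder (k + m) A (to_totfrac x *: f))).
  by rewrite addn0 rmorph1 scale1r.
move=> m i S h; rewrite rmorphM -scalerA addnS.
exact: Intder_mul_sq0 (eps_sq _ _) h.
Qed.

Lemma Intder_coord k g S :
  Intder k A (eps_comb g) -> Intder (n + k - #|S|) R (g S).
Proof.
move=> hg; have /IntderP h := Intder_epsS (U := ~: S) hg; apply/IntderP => j a.
have := cardsC S; rewrite card_ord => cS jm.
have {}jm : (j <= k + #|~: S|)%N by lia.
apply: (@ring_image_coord _ _ (fun S => (g S)^`(j).[to_totfrac a])).
rewrite -derivn_eps_comb_scalar mulrC -hornerZ -derivnZ.
exact: h.
Qed.

(** Adding a term c eps_T, with T nonempty, to the argument changes the value
    by h'(x) c eps_T eps_S.  If T meets S this is zero; otherwise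
    eps_T eps_S = eps_(T u S), and the derivative that h loses is paid for by
    |T| >= 1.  Hence the statement has to be proved for all S and h at once. *)
Lemma ring_image_map_horner_epsS (x : A) S h : Intder (n - #|S|) R h ->
  (map_poly iota h).[to_totfrac x] * E S \in ring_image A.
Proof.
have [c ->] := eps_expand x; rewrite (bigD1 finset.set0) //= epsS0 mulr1.
elim/big_rec: _ S h => [|T y T0 IH] S h hS.
  rewrite addr0 -totfrac_eps_scalar horner_map.
  move/IntderP: hS => /(_ 0%N (c finset.set0) isT) /ring_imageP[b /= ->].
  by rewrite totfrac_eps_scalar rpredM ?ring_image_to_totfrac.
rewrite addrCA addrC rmorphD horner_sq0; last first.
  by rewrite -rmorphM mulrACA epsS_sq // mulr0 rmorph0.
rewrite mulrDl rpredD ?IH // -mulrA -rmorphM -mulrA.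
have [dTS|/epsSM0 ->] := boolP [disjoint T & S]; last first.
  by rewrite mulr0 rmorph0 mulr0 rpred0.
rewrite epsSU // rmorphM mulrCA rpredM ?ring_image_to_totfrac // deriv_map.
apply: IH; rewrite -derivn1; apply: Intder_derivn; apply: Intder_le hS.
have := subset_leq_card (finset.subsetT (T :|: S)).
rewrite cardsT card_ord cardsU.
rewrite (eqP _ : T :&: S = finset.set0) ?finset.setI_eq0 //.
have : (0 < #|T|)%N by rewrite card_gt0.
by rewrite cards0; move: #|T| #|S| => p q; lia.
Qed.

Lemma Intder_epsS_map k S h :
  Intder (n + k - #|S|) R h -> Intder k A (E S *: map_poly iota h).
Proof.
move=> hS; apply/IntderP => j x jk.
rewrite derivnZ derivn_map hornerZ mulrC; apply: ring_image_map_horner_epsS.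
apply: Intder_derivn; apply: Intder_le hS.
by have := max_card (mem S); rewrite card_ord; move: #|S| => p; lia.
Qed.

Lemma Intder_eps_combP k g :
  Intder k A (eps_comb g) <-> forall S, Intder (n + k - #|S|) R (g S).
Proof.
split=> [h S|h]; first exact: Intder_coord.
by rewrite eps_combE; apply: Intder_sum => S _; apply: Intder_epsS_map.
Qed.

End EpsPoly.

(** * Powers of the ideal of infinitesimals *)

Section Mulset.
Variable V : comNzRingType.
Implicit Types (A B H : set V).

Lemma mulset_mul A B a b : A a -> B b -> mulset A B (a * b).
Proof. by move=> Aa Bb; apply: sub_gen_smallest; exists a => //; exists b. Qed.

Lemma mulset_sum A B (I : Type) (r : seq I) (P : pred I) (F : I -> V) :
  (forall i, P i -> mulset A B (F i)) -> mulset A B (\sum_(i <- r | P i) F i).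
Proof.
move=> hF H [cH sH].
have hFH i : P i -> F i \in H by move=> /hF hi; rewrite inE; apply: hi.
suff : \sum_(i <- r | P i) F i \in H by rewrite inE.
elim/big_rec: _ => [|i x Pi Hx]; first exact: cH.1.
exact: (GRing.zmod_closedD cH).2 (hFH i Pi) Hx.
Qed.

Lemma mulset_sub A B H : GRing.zmod_closed (mem H) ->
  (forall a b, A a -> B b -> H (a * b)) -> (forall c, mulset A B c -> H c).
Proof.
move=> cH h; apply: smallest_sub => // _ [a Aa [b Bb <-]]; exact: h.
Qed.

End Mulset.

Section IdealPowers.
Variables (R : comNzRingType) (n : nat).
Implicit Types (S T U : {set 'I_n}) (i : 'I_n).
Implicit Types (g : {ffun {set 'I_n} -> {poly totfrac R}}).
Implicit Types (h : {poly totfrac R}).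
Local Notation A := (eps_ring R n).
Local Notation E S := (to_totfrac (@epsS R n S)).
Local Notation iota := (totfrac_eps R n).
Local Notation I := (ideal_of (@eps R n)).

Lemma ideal_pow_epsS S : ideal_pow I #|S| (epsS R S).
Proof.
apply: (@epsS_ind R n (fun m x => ideal_pow I m x)) => // m i T h.
by apply: mulset_mul => //; apply: ideal_of_gen.
Qed.

(** The presence of S makes the induction on m work: a generator eps_i of the
    ideal either kills eps_S or turns it into the monomial of a set with one
    more element, which trades one power of the ideal for one element of S. *)
Lemma Intder_ideal_pow k m a : ideal_pow I m a -> forall S h,
  Intder (n + k - #|S| - m) R h ->
  Intder k A (to_totfrac a *: (E S *: map_poly iota h)).
Proof.
elim: m a => [|m IH] a.
  by move=> _ S h; rewrite subn0 => hS; apply/Intder_scale/Intder_epsS_map.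
move: a; apply: (@mulset_sub _ _ _ [set a | forall S h,
  Intder (n + k - #|S| - m.+1) R h ->
  Intder k A (to_totfrac a *: (E S *: map_poly iota h))]%classic).
  split=> [|a b]; rewrite !inE /=.
    by move=> S h _; rewrite rmorph0 scale0r; apply: Intder0.
  move=> ha hb S h hS; rewrite rmorphB scalerBl.
  by apply: IntderB; [apply: ha | apply: hb].
move=> _ b [q ->] hb S h hS.
rewrite mulr_suml rmorph_sum scaler_suml; apply: Intder_sum => i _.
rewrite -mulrA !rmorphM -scalerA; apply: Intder_scale.
rewrite mulrC -scalerA (scalerA _ (E S)) -rmorphM -epsS1.
have [diS|/epsSM0 ->] := boolP [disjoint [set i]%SET & S]; last first.
  by rewrite rmorph0 scale0r scaler0; apply: Intder0.
rewrite epsSU //; apply: IH hb _ _ _.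
suff ->: #|[set i]%SET :|: S| = #|S|.+1 by rewrite -subnDA addSnnS subnDA.
by rewrite cardsU1; move: diS; rewrite disjoints1 => ->.
Qed.

End IdealPowers.

Local Open Scope classical_set_scope.

Theorem theorem1p1 (R : comNzRingType) (n k : nat) (n_gt0 : (0 < n)%N) :
  [/\ Intder k (eps_ring R n) =
        sumset (fun i : 'I_n.+1 =>
          mulset [set (to_totfrac a)%:P | a in ideal_pow (ideal_of (@eps R n)) i]
                 (eps_ext (Intder (n + k - i) R))),
      Intder k (eps_ring R n) =
        [set eps_comb g | g in [set g : {ffun {set 'I_n} -> {poly totfrac R}} |
           forall S : {set 'I_n}, Intder (n + k - #|S|) R (g S)]]
    & injective (@eps_comb R n)].
Proof.
split; last exact: eps_comb_inj.
- apply/seteqP; split=> [f hf|_ [F hF <-]]; last first.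
    apply: Intder_sum => i _; apply: mulset_sub (hF i).
      exact: Intder_zmod_closed.
    move=> _ _ [a ha <-] [g hg <-]; rewrite mul_polyC eps_combE scaler_sumr.
    apply: Intder_sum => S _; apply: (Intder_ideal_pow ha).
    by apply: Intder_le (hg S); rewrite subnAC leq_subr.
  have [g fg] := eps_comb_surj f.
  move: hf; rewrite {}fg => /Intder_eps_combP hg.
  (* The component in the i-th power of the ideal gathers the S of size i. *)
  exists (fun i : 'I_n.+1 =>
    \sum_(S : {set 'I_n} | inord #|S| == i) map_poly (totfrac_eps R n) (g S)
                                 * (to_totfrac (epsS R S))%:P).
    move=> i; apply: mulset_sum => S /eqP <-.
    rewrite inordK ?ltnS; last by rewrite -[X in (_ <= X)%N]card_ord max_card.
    rewrite mulrC; apply: mulset_mul.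
      by exists (epsS R S); first exact: ideal_pow_epsS.
    exists [ffun T => if T == finset.set0 then g S else 0].
      by move=> T; rewrite ffunE; case: eqP => _; [exact: hg | exact: Intder0].
    exact: eps_comb_const.
  rewrite /eps_comb.
  by rewrite [RHS](partition_big
    (fun S : {set 'I_n} => inord #|S| : 'I_n.+1) predT).
- apply/seteqP; split=> [f|_ [g hg <-]]; last exact/Intder_eps_combP.
  by have [g ->] := eps_comb_surj f => /Intder_eps_combP hg; exists g.
Qed.
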